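(* On a $\lambda$-normed plane, the solution of the Fermat--Torricelli problem is unique for any three points (that is, $\operatorname{ft}(\{x_1,x_2,x_3\})$ consists of exactly one point for every set of three points $x_1,x_2,x_3$ of the plane) if and only if $\lambda\not\equiv 0 \pmod 3$.
   Context: A $\lambda$-normed plane ($\lambda\ge 2$ an integer) is the plane $\mathbb{R}^2$ with the norm $\|\cdot\|$ whose unit circle is (the boundary of) a regular $2\lambda$-gon centred at the origin. For a finite set $A=\{x_1,\dots,x_n\}$ of points of a normed space, a point $x_0$ is a Fermat--Torricelli point of $A$ if $x=x_0$ minimizes $\sum_{i=1}^n\|x-x_i\|$; the set of all such points is denoted $\operatorname{ft}(A)$. *)

(* Defs.v *)
From HB Require Import structures.
From mathcomp Require Import all_boot all_order all_algebra finmap.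
From mathcomp Require Import all_classical all_reals all_analysis.

Set Implicit Arguments.
Unset Strict Implicit.
Unset Printing Implicit Defensive.
Import Order.TTheory GRing.Theory Num.Theory.

Local Open Scope classical_set_scope.
Local Open Scope ring_scope.

(* A norm is a plain function, because ['rV[R]_2] already carries the maximum
   norm as its canonical normed-module structure. *)
Record is_norm (R : realType) (V : lmodType R) (N : V -> R) : Prop := IsNorm {
  norm_eq0 : forall x, N x = 0 -> x = 0;
  norm_scale : forall (a : R) x, N (a *: x) = `|a| * N x;
  norm_triangle : forall x y, N (x + y) <= N x + N y }.

Definition segment (R : realType) (V : lmodType R) (a b : V) : set V :=
  [set (1 - s) *: a + s *: b | s in `[0 : R, 1]].

Definition polar (R : realType) (r theta : R) : 'rV[R]_2 :=
  r *: \row_(i < 2) [:: cos theta; sin theta]`_i.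

Definition regular_vertex (R : realType) (n : nat) (r theta : R) (k : nat) :
  'rV[R]_2 := polar r (theta + 2 * pi * k%:R / n%:R).

(* The polygon is the closed polygonal curve formed by its [n] sides, i.e. the
   boundary of the polygonal region; it is centred at the origin, with arbitrary
   circumradius and orientation.  The last side closes up because the vertices
   [n] and [0] coincide.  Only meaningful for [3 <= n]. *)
Definition is_regular_polygon (R : realType) (n : nat) (P : set 'rV[R]_2) :
    Prop :=
  exists r theta : R, 0 < r /\
    P = \bigcup_(k < n)
          segment (regular_vertex n r theta k) (regular_vertex n r theta k.+1).

Definition is_lambda_norm (R : realType) (lambda : nat) (N : 'rV[R]_2 -> R) :
    Prop :=
  is_norm N /\ is_regular_polygon (2 * lambda)%N [set x | N x = 1].

Definition ft (R : realType) (V : lmodType R) (N : V -> R) (A : {fset V}) :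
    set V :=
  [set x0 | forall x, \sum_(a <- A) N (x0 - a) <= \sum_(a <- A) N (x - a)].

(* Main.v *)
Require Import Defs.
From HB Require Import structures.
From mathcomp Require Import all_boot all_order all_algebra finmap.
From mathcomp Require Import all_classical all_reals all_analysis.
From mathcomp Require Import zify ring lra.

Import Order.TTheory GRing.Theory Num.Theory.
Import numFieldNormedType.Exports.

Local Open Scope fset_scope.
Local Open Scope classical_set_scope.
Local Open Scope ring_scope.

(** Let [alpha = pi / (2 * lambda)].  The norm is the maximum of [2 * lambda]
    linear forms [facet k], one for each side of the unit circle; in the frame of
    a vertex their gradients are, up to a common factor, unit vectors at odd
    multiples of [alpha].  A form is active at [v] if it equals the norm there:
    one form is active inside the cone over a side, two on the ray through a
    vertex.

    A minimiser exists by compactness.  Suppose that the sum of the distances to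
    three points has two minimisers [p] and [q], with midpoint [m].  By convexity
    each distance is affine on the segment from [p] to [q], so the forms active
    at [m - x_i] agree on [q - p].  Hence either a single form is active at
    [m - x_i], or [m - x_i] and [q - p] lie on the line through a vertex
    ([midpoint_rigid_or_radial]).  Minimality at [m] says that in every direction
    some choice of active forms has a nonnegative sum ([minimizer_descent]).

    If a single form is active at each of the three differences, three unit
    vectors add up to zero.  They form angles of 120 degrees, and as two of them
    differ by a multiple of [pi / lambda], 3 divides [lambda]
    ([rigid_unbalanced]).  Otherwise use the frame of the vertex parallel to
    [q - p] ([radial_unbalanced]).  If only one difference is parallel to it,
    minus the sum of the two other gradients lies on a chord between two
    neighbouring gradients; it is then either an end of this chord, and again 3
    divides [lambda], or its middle, and [2 * cos (q * alpha) = cos alpha] up to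
    sign for some odd [q] ([no_edge_sum]).  The latter is impossible since
    [cos (q * alpha) / cos alpha] is an algebraic integer for odd [q] and [1 / 2]
    is not ([twice_odd_cos_neq]).  If two differences are parallel to the vertex,
    the third gradient is orthogonal to it, which needs an odd [lambda], and is
    balanced by two components of size at most [sin alpha], which needs
    [lambda <= 3]; so [lambda = 3] ([no_facet_across]).

    Conversely, if 3 divides [lambda], three of the gradients form angles of 120
    degrees and add up to zero.  Three points placed so that these are the
    gradients of the distances at the origin, each in the interior of a region of
    linearity, have the origin and all points near it as minimisers
    ([minimizer_not_unique]). *)

(** * Cosines of multiples of a fraction of a turn *)
Section Cosines.
Set Implicit Arguments.
Unset Strict Implicit.
Unset Printing Implicit Defensive.
Variable R : realType.
Implicit Types (x y : R) (m p q : int) (n : nat).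

Lemma cosD_int2pi x m : cos (x + m%:~R * (2 * pi)) = cos x.
Proof.
have H (k : nat) y : cos (y + k%:R * (2 * pi)) = cos y.
  elim: k => [|k IH] in y *; first by rewrite mul0r addr0.
  have -> : y + k.+1%:R * (2 * pi) = (y + k%:R * (2 * pi)) + pi *+ 2.
    by rewrite -natr1; ring.
  by rewrite cosD2pi.
case: m => k; first exact: H.
rewrite -[LHS](H k.+1); congr cos.
by rewrite NegzE rmorphN /= -pmulrn; ring.
Qed.

(** Every angle is, up to sign and full turns, an angle of [[0, pi]], where
    cosine is injective and decreasing. *)
Lemma cos_fold x : exists (m : int) y,
  [/\ 0 <= y, y <= pi, cos y = cos x &
      x = m%:~R * (2 * pi) + y \/ x = m%:~R * (2 * pi) - y].
Proof.
have pi0 : 0 < pi :> R := pi_gt0 R.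
(* The angle reduced to [[0, 2 * pi)] by [m] turns is reflected when above [pi]. *)
pose m := Num.floor (x / (2 * pi)).
have tp : 0 < 2 * pi :> R by lra.
have := floor_itv (x / (2 * pi)); rewrite -/m => /andP[h1 h2].
have {}h1 : m%:~R * (2 * pi) <= x by rewrite -ler_pdivlMr.
have {}h2 : x < m%:~R * (2 * pi) + 2 * pi.
  by move: h2; rewrite ltr_pdivrMr // intrD mulrDl mul1r.
have [le|gt] := lerP (x - m%:~R * (2 * pi)) pi.
  exists m, (x - m%:~R * (2 * pi)); split; [lra|done| |by left; ring].
  by rewrite -[RHS](cosD_int2pi _ (- m)) rmorphN; congr cos; rewrite mulNr.
exists (m + 1), (m%:~R * (2 * pi) + 2 * pi - x); split; [lra|lra| |].
  by rewrite -cosN -[RHS](cosD_int2pi _ (- (m + 1))) mulrNz intrD; congr cos; ring.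
by right; rewrite intrD; ring.
Qed.

Lemma cos_eq1 x : cos x = 1 -> exists m : int, x = m%:~R * (2 * pi).
Proof.
have pi0 : 0 < pi :> R := pi_gt0 R.
move=> x1; have [m [y [y0 ypi cy H]]] := cos_fold x.
have y00 : y = 0.
  by apply: cos_inj; rewrite ?in_itv /= ?y0 ?ypi ?lexx ?(ltW pi0) // cos0 cy.
by exists m; case: H => ->; rewrite y00; ring.
Qed.

(** Folding a multiple of [pi / n] into [[0, pi]] gives [k * (pi / n)] with [k]
    a natural number, and cosine decreases there: [k >= 1] unless the multiple
    is a whole number of turns. *)
Lemma cos_mulstep_le n p : (0 < n)%N ->
  (exists m : int, p = m * (2 * n)%N%:Z) \/
  cos (p%:~R * (pi / n%:R)) <= cos (pi / n%:R) :> R.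
Proof.
have pi0 : 0 < pi :> R := pi_gt0 R.
move=> n0; have nR : 0 < n%:R :> R by rewrite ltr0n.
have [m [y [y0 ypi cy H]]] := cos_fold (p%:~R * (pi / n%:R)).
pose k : int := p - m * (2 * n)%N%:Z.
have s0 : 0 < pi / n%:R :> R by rewrite divr_gt0.
have spi : pi / n%:R <= pi :> R.
  by rewrite ler_pdivrMr // ler_peMr ?ler1n // ltW.
have Ek : k%:~R * (pi / n%:R) = p%:~R * (pi / n%:R) - m%:~R * (2 * pi) :> R.
  rewrite /k intrB intrM -[(2 * n)%N%:Z%:~R]/((2 * n)%N%:R) natrM.
  by field; rewrite gt_eqF.
have [k0|k0] := eqVneq k 0; first by left; exists m; lia.
right; rewrite -cy.
suff sy : pi / n%:R <= y.
  move: sy; rewrite le_eqVlt => /orP[/eqP <-//|sy].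
  by apply: ltW; rewrite ltr_cos // in_itv /= ?y0 ?ypi ?spi ?(ltW s0).
have -> : y = `|k|%:~R * (pi / n%:R).
  have -> : y = `|k%:~R * (pi / n%:R)|.
    rewrite Ek; case: H => ->.
      by rewrite addrC addKr ger0_norm.
    by rewrite addrC addKr normrN ger0_norm.
  by rewrite normrM intr_norm (ger0_norm (ltW s0)).
rewrite ler_peMl ?(ltW s0) //.
by rewrite -[1]/(1%:~R) ler_int; lia.
Qed.

Lemma cos_mulr3n x : cos (3 * x) = 4 * cos x ^+ 3 - 3 * cos x.
Proof.
have -> : 3 * x = x + x + x by ring.
have E := sin2cos2 x; rewrite expr2 in E.
rewrite !cosD !sinD; transitivity
  (cos x * cos x * cos x - 3 * (sin x * sin x) * cos x); first by ring.
by rewrite E; ring.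
Qed.

(** By the triple angle formula the cosine of the tripled angle is 1, so
    [3 * p = 2 * m * n]; if 3 did not divide [n] it would divide [m], and the
    angle itself would be a whole number of turns, of cosine 1. *)
Lemma cos_Nhalf_dvd3 n p : (0 < n)%N ->
  2 * cos (p%:~R * (pi / n%:R)) = -1 :> R -> (3 %| n)%N.
Proof.
move=> n0; set x := p%:~R * _ => cx.
have {}cx : cos x = - 1 / 2 by lra.
have : cos (3 * x) = 1 by rewrite cos_mulr3n cx; field.
have nR : 0 < n%:R :> R by rewrite ltr0n.
have pi0 : 0 < pi :> R := pi_gt0 R.
case/cos_eq1 => m Em.
have E : 3 * p = 2 * m * n%:Z.
  apply: (@intr_inj R); rewrite !intrM -[n%:Z%:~R]/(n%:R).
  apply: (mulIf (x := pi)); first by rewrite gt_eqF.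
  have := congr1 (fun t => t * n%:R) Em; rewrite /x => E.
  transitivity (3 * (p%:~R * (pi / n%:R)) * n%:R :> R).
    by field; rewrite gt_eqF.
  by rewrite E; ring.
have : (3 %| 2 * (`|m| * n))%N.
  by apply/dvdnP; exists `|p|%N; have := congr1 absz E; rewrite !abszM /=; lia.
rewrite Gauss_dvdr // Euclid_dvdM // => /orP[|//].
case/dvdnP => k Ek.
have [m' Em'] : exists m', m = 3 * m' by exists (sgz m * k%:Z); lia.
move: cx; have -> : x = m'%:~R * (2 * pi).
  apply: (mulfI (x := 3)); first by [].
  by rewrite Em Em' intrM; ring.
by rewrite -[X in cos X]add0r cosD_int2pi cos0; lra.
Qed.

Lemma cos_half_dvd3 n p : (0 < n)%N ->
  4 * cos (p%:~R * (pi / n%:R)) ^+ 2 = 1 :> R -> (3 %| n)%N.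
Proof.
move=> n0 E; apply: (@cos_Nhalf_dvd3 n (2 * p) n0).
rewrite intrM; have -> : 2%:~R * p%:~R * (pi / n%:R) = (p%:~R * (pi / n%:R)) *+ 2 :> R.
  by ring.
by rewrite cos_mulr2n; lra.
Qed.
End Cosines.

(** * A divisibility obstruction: one half is not an algebraic integer *)
Section HalfNotIntegral.
Set Implicit Arguments.
Unset Strict Implicit.
Unset Printing Implicit Defensive.
Variable R : realType.
Implicit Types (x y : R) (m p q : int) (n : nat).

Notation Zintegral := (@integralOver int R intr).

(** The rescaled Chebyshev polynomials: [dickson n] sends [2 * cos x] to
    [2 * cos (n * x)].  Unlike the Chebyshev polynomials they are monic from
    degree 1 on, which makes [2 * cos x] an algebraic integer at rational angles. *)
Fixpoint dickson n : {poly int} :=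
  if n is k.+1 then
    if k is j.+1 then 'X * dickson k - dickson j else 'X
  else 2%:P.

Lemma dicksonSS n : dickson n.+2 = 'X * dickson n.+1 - dickson n.
Proof. by []. Qed.

Lemma size_dickson_monic n :
  size (dickson n.+1) = n.+2 /\ dickson n.+1 \is monic.
Proof.
suff H : forall k, (size (dickson k) <= k.+1)%N /\
   (size (dickson k.+1) = k.+2 /\ dickson k.+1 \is monic) by case: (H n).
elim=> [|k [IH0 [IH1 IH2]]].
  by rewrite /= size_polyX monicX size_polyC.
split; first by rewrite IH1.
have d0 : dickson k.+1 != 0 by rewrite monic_neq0.
have sX : size ('X * dickson k.+1) = k.+3 by rewrite mulrC size_mulX ?IH1.
have lt : (size (- dickson k) < size ('X * dickson k.+1)%R)%N.
  by rewrite size_polyN sX (leq_ltn_trans IH0).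
rewrite dicksonSS size_polyDl // sX; split=> //.
by rewrite monicE lead_coefDl // lead_coefM lead_coefX mul1r -monicE.
Qed.

Lemma dickson_cos n x :
  (map_poly intr (dickson n)).[2 * cos x] = 2 * cos (n%:R * x).
Proof.
suff: (map_poly intr (dickson n)).[2 * cos x] = 2 * cos (n%:R * x) /\
      (map_poly intr (dickson n.+1)).[2 * cos x] = 2 * cos (n.+1%:R * x).
  by case.
elim: n => [|n [IH0 IH1]].
  by rewrite /= mul0r cos0 mul1r map_polyX hornerX map_polyC hornerC mulr1.
split=> //; rewrite dicksonSS rmorphB rmorphM /= map_polyX hornerD hornerN.
rewrite hornerM hornerX IH0 IH1.
have -> : n.+2%:R * x = n.+1%:R * x + x by rewrite -[in LHS]natr1; ring.
have -> : n%:R * x = n.+1%:R * x - x by rewrite -[in RHS]natr1; ring.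
by rewrite !cosD cosN sinN; ring.
Qed.

(** Multiplying the angle by [2 * n] gives whole turns, so [2 * cos] of it is a
    root of the monic polynomial [dickson (2 * n) - 2]. *)
Lemma integral_2cos n p : (0 < n)%N ->
  Zintegral (2 * cos (p%:~R * (pi / n%:R))).
Proof.
move=> n0; have nR : n%:R != 0 :> R by rewrite pnatr_eq0 -lt0n.
pose k := (2 * n).-1.
have kE : k.+1 = (2 * n)%N by rewrite /k; lia.
have [sz mon] := size_dickson_monic k.
exists (dickson k.+1 - 2%:P).
  rewrite monicE lead_coefDl -?monicE //.
  by rewrite size_polyN size_polyC sz (leq_ltn_trans (leq_b1 _)).
have -> : map_poly intr (dickson k.+1 - 2%:P) =
          map_poly intr (dickson k.+1) - 2%:P :> {poly R}.
  by rewrite rmorphB; congr (_ - _); rewrite /= map_polyC.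
rewrite rootE hornerD hornerN hornerC dickson_cos kE.
have -> : (2 * n)%N%:R * (p%:~R * (pi / n%:R)) = 0 + p%:~R * (2 * pi) :> R.
  by rewrite natrM; field.
by rewrite cosD_int2pi cos0 mulr1 subrr.
Qed.

(** Clearing denominators in a monic integer equation satisfied by [1 / 2]
    leaves an even integer equal to [-1]. *)
Lemma half_not_integral : ~ Zintegral 2^-1.
Proof.
case=> P monP; rewrite /root horner_coef size_map_poly_id0; last first.
  by rewrite (monicP monP) oner_eq0.
have := monicP monP; rewrite lead_coefE.
have : (0 < size P)%N by rewrite size_poly_gt0 monic_neq0.
case: (size P) => // d _ /= lc.
rewrite big_ord_recr /= coef_map lc mul1r => /eqP E.
have : 2 * (\sum_(i < d) P`_i * 2 ^+ (d.-1 - i)) = -1 :> int.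
  apply: (@intr_inj R); rewrite intrM rmorph_sum /=.
  move/(congr1 (fun t => t * 2 ^+ d)): E; rewrite mul0r mulrDl -exprMn.
  rewrite mulVf // expr1n => /eqP; rewrite addr_eq0 => /eqP E.
  transitivity (- 1 : R); last by [].
  rewrite -E.
  rewrite mulr_suml mulr_sumr; apply: eq_bigr => i _.
  have id := ltn_ord i.
  have E2 : 2^-1 ^+ i * 2 ^+ d = 2 * 2 ^+ (d.-1 - i) :> R.
    have -> : 2 ^+ d = 2 ^+ i * 2 ^+ (d - i) :> R.
      by rewrite -exprD subnKC // ltnW.
    rewrite mulrA -exprMn mulVf // expr1n.
    by rewrite mul1r -exprS; congr (_ ^+ _); lia.
  rewrite coef_map intrM rmorphXn /= -mulrA E2.
  by rewrite mulrCA.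
by lia.
Qed.

(** Two consecutive ratios add up to [2 * cos ((2 * k + 2) * a)], so integrality
    propagates from the ratio 1 at [k = 0]. *)
Lemma odd_cos_ratio_integral n k : (0 < n)%N ->
  let a := pi / n%:R : R in cos a != 0 ->
  Zintegral (cos ((2 * k + 1)%N%:R * a) / cos a).
Proof.
move=> n0 a ca; elim: k => [|k IH].
  by rewrite muln0 add0n mul1r divff //; apply: integral1.
have -> : cos ((2 * k.+1 + 1)%N%:R * a) / cos a =
   2 * cos ((2 * k + 2)%N%:Z%:~R * a) - cos ((2 * k + 1)%N%:R * a) / cos a.
  apply: (mulIf ca); rewrite mulrBl !mulfVK //.
  rewrite -[(2 * k + 2)%N%:Z%:~R]/((2 * k + 2)%N%:R).
  have -> : (2 * k.+1 + 1)%N%:R * a = (2 * k + 2)%N%:R * a + a.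
    by rewrite -[X in _ + X]mul1r -mulrDl natr1; congr (_%:R * _); lia.
  have -> : (2 * k + 1)%N%:R * a = (2 * k + 2)%N%:R * a - a.
    have -> : (2 * k + 2)%N%:R = (2 * k + 1)%N%:R + 1 :> R.
      by rewrite natr1; congr _%:R; lia.
    by ring.
  by rewrite !cosD cosN sinN; ring.
by apply: integral_sub => //; apply: integral_2cos.
Qed.

(** Equality would make [1 / 2], up to sign, the integral ratio
    [cos (q * a) / cos a]. *)
Lemma twice_odd_cos_neq n q : (2 < n)%N -> odd `|q| ->
  4 * cos (q%:~R * (pi / n%:R)) ^+ 2 != cos (pi / n%:R) ^+ 2 :> R.
Proof.
move=> n2 oq; set a := pi / n%:R.
have n0 : (0 < n)%N by lia.
have ca : cos a != 0.
  have pi0 : 0 < pi :> R := pi_gt0 R.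
  have nR : 2 < n%:R :> R by rewrite ltr_nat.
  rewrite gt_eqF // cos_gt0_pihalf // /a; apply/andP; split.
    by apply: (@lt_trans _ _ 0); rewrite ?oppr_lt0 divr_gt0 //; lra.
  by rewrite ltr_pM2l // ltf_pV2 ?posrE //; lra.
apply/eqP => E.
have cq : cos (q%:~R * a) = cos (`|q|%N%:R * a).
  case: q {oq E} => k //=; rewrite NegzE -cosN; congr cos.
  by rewrite mulrNz mulNr opprK -pmulrn.
have := odd_double_half `|q|; rewrite oq => Eq.
have I := @odd_cos_ratio_integral n (`|q|)./2 n0 ca.
have {}I : Zintegral (cos (q%:~R * a) / cos a).
  by rewrite cq -[in (`|q|)%:R]Eq addnC -mul2n.
apply: half_not_integral.
move: E => /eqP; rewrite -[4](_ : 2 ^+ 2 = _); last by ring.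
rewrite -exprMn eqf_sqr => /orP[] /eqP E.
  have -> : 2^-1 = cos (q%:~R * a) / cos a.
    have -> : cos (q%:~R * a) = cos a / 2 by rewrite -E; field.
    by field.
  exact: I.
have -> : 2^-1 = - (cos (q%:~R * a) / cos a).
  have -> : cos (q%:~R * a) = - cos a / 2 by rewrite -E; field.
  by field.
by apply: integral_opp.
Qed.
End HalfNotIntegral.

(** * Three directions among the side normals of a regular polygon *)
Lemma cos_pi3 (R : realType) : cos (pi / 3) = 1 / 2 :> R.
Proof.
have pi0 : 0 < pi :> R := pi_gt0 R.
have c0 : 0 < cos (pi / 3) :> R by apply: cos_gt0_pihalf; apply/andP; split; lra.
have := cos_mulr3n (pi / 3 : R).
have -> : 3 * (pi / 3) = pi :> R by field.
rewrite cospi => E.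
(* The triple angle formula, factored; [cos (pi / 3) = -1] is a spurious root. *)
have : (cos (pi / 3) + 1) * (2 * cos (pi / 3) - 1) ^+ 2 = 0 :> R.
  transitivity (4 * cos (pi / 3) ^+ 3 - 3 * cos (pi / 3) + 1 : R); first by ring.
  by rewrite -E; ring.
by move/eqP; rewrite mulf_eq0 sqrf_eq0 => /orP[] /eqP; lra.
Qed.

Section HalfStep.
Set Implicit Arguments.
Unset Strict Implicit.
Unset Printing Implicit Defensive.
Variables (R : realType) (lambda : nat).
Hypothesis lambda2 : (2 <= lambda)%N.
Implicit Types (i j k p q : int).

(** Half of the angle between neighbouring vertices of the regular
    [2 * lambda]-gon: the angle between a side normal and either end of the
    side. *)
Definition halfstep : R := pi / (2 * lambda)%N%:R.
Notation alpha := halfstep.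

Lemma halfstep_double : alpha *+ 2 = pi / lambda%:R.
Proof.
have : lambda%:R != 0 :> R by rewrite pnatr_eq0; lia.
by move=> ?; rewrite /halfstep natrM; field.
Qed.

Lemma halfstep_itv : 0 < alpha < pi / 2.
Proof.
have pi0 : 0 < pi :> R := pi_gt0 R.
have l2 : 2 <= lambda%:R :> R by rewrite ler_nat.
rewrite /halfstep natrM divr_gt0 ?mulr_gt0 //=; last by lra.
by rewrite ltr_pM2l // ltf_pV2 ?posrE; lra.
Qed.

Lemma cos_halfstep_gt0 : 0 < cos alpha.
Proof.
have /andP[a0 a1] := halfstep_itv; apply: cos_gt0_pihalf.
by rewrite a1 andbT (lt_trans _ a0) // oppr_lt0 (lt_trans a0).
Qed.

Lemma sin_halfstep_gt0 : 0 < sin alpha.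
Proof. exact: sin_gt0_pihalf halfstep_itv. Qed.

Lemma cos_dbl k : cos (k%:~R * (pi / lambda%:R)) = 2 * cos (k%:~R * alpha) ^+ 2 - 1.
Proof. by rewrite -halfstep_double mulrnAr cos_mulr2n mulr_natl. Qed.

(** The angle from vertex [k] of the polygon to the normal of side [i] is
    [odd_angle (i - k)]. *)
Definition odd_angle j : R := (2 * j + 1)%:~R * alpha.

Lemma cos_odd_le j : cos (odd_angle j) <= cos alpha.
Proof.
have l0 : (0 < 2 * lambda)%N by lia.
by case: (cos_mulstep_le R (2 * j + 1) l0) => // -[m]; lia.
Qed.

Lemma odd_angle_antipode j : odd_angle (j + lambda) = odd_angle j + pi.
Proof.
have l0 : lambda%:R != 0 :> R by rewrite pnatr_eq0; lia.
rewrite /odd_angle /halfstep !intrD !intrM !intrD natrM.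
by rewrite -[lambda%:Z%:~R]/(lambda%:R : R); field.
Qed.

Lemma cos_odd_ge j : - cos alpha <= cos (odd_angle j).
Proof. by rewrite lerNl -cosDpi -odd_angle_antipode cos_odd_le. Qed.

(** Three unit vectors of sum zero form angles of 120 degrees, and the normals
    of two sides differ by a multiple of [pi / lambda]. *)
Lemma unit_triple_dvd3 i j k :
  cos (odd_angle i) + cos (odd_angle j) + cos (odd_angle k) = 0 ->
  sin (odd_angle i) + sin (odd_angle j) + sin (odd_angle k) = 0 ->
  (3 %| lambda)%N.
Proof.
move=> C S; have l0 : (0 < lambda)%N by lia.
apply: (@cos_Nhalf_dvd3 R lambda (i - j) l0).
have -> : (i - j)%:~R * (pi / lambda%:R) = odd_angle i - odd_angle j.
  rewrite -halfstep_double /odd_angle intrB !intrD !intrM mulr1z mulr2n.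
  by ring.
rewrite cosB.
have := cos2Dsin2 (odd_angle i); have := cos2Dsin2 (odd_angle j).
have := cos2Dsin2 (odd_angle k).
have -> : cos (odd_angle k) = - (cos (odd_angle i) + cos (odd_angle j)).
  by rewrite -[RHS]addr0 -C; ring.
have -> : sin (odd_angle k) = - (sin (odd_angle i) + sin (odd_angle j)).
  by rewrite -[RHS]addr0 -S; ring.
nra.
Qed.

Hypothesis lambda3 : ~~ (3 %| lambda)%N.

(** In the frame of a vertex [V], the hypotheses say that minus the sum of two
    side normals ends on the chord joining the unit vectors at the angles
    [- alpha] and [alpha].  Up to sign, that sum has length [2 * cos (q * alpha)] and direction
    [p * alpha]; the chord spans only the directions from [- alpha] to [alpha],
    hence leaves two cases modulo a half turn.  If the sum points at an end of
    the chord, it has length 1, so [4 * cos (q * alpha) ^+ 2 = 1], which needs 3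
    to divide [2 * lambda].  If it points at the middle, its length is
    [cos alpha] with [q] odd, which [twice_odd_cos_neq] excludes. *)
Lemma no_edge_sum i j :
  cos alpha + cos (odd_angle i) + cos (odd_angle j) = 0 ->
  `|sin (odd_angle i) + sin (odd_angle j)| <= sin alpha -> False.
Proof.
have l0 : (0 < lambda)%N by lia.
have tl0 : (0 < 2 * lambda)%N by lia.
have ca0 := cos_halfstep_gt0; have sa0 := sin_halfstep_gt0.
(* Half the sum and half the difference of the odd numbers [2i + 1] and [2j + 1]. *)
set p := i + j + 1; set q := i - j.
have Ei : odd_angle i = p%:~R * alpha + q%:~R * alpha.
  by rewrite /odd_angle -mulrDl -intrD; congr (_%:~R * _); rewrite /p /q; lia.
have Ej : odd_angle j = p%:~R * alpha - q%:~R * alpha.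
  by rewrite /odd_angle -mulrBl -intrB; congr (_%:~R * _); rewrite /p /q; lia.
rewrite Ei Ej !cosD !sinD cosN sinN => C S.
have {S} S2 : (2 * (sin (p%:~R * alpha) * cos (q%:~R * alpha))) ^+ 2 <= sin alpha ^+ 2.
  have -> : 2 * (sin (p%:~R * alpha) * cos (q%:~R * alpha)) =
    sin (p%:~R * alpha) * cos (q%:~R * alpha) + cos (p%:~R * alpha) * sin (q%:~R * alpha)
    + (sin (p%:~R * alpha) * cos (q%:~R * alpha)
       + cos (p%:~R * alpha) * - sin (q%:~R * alpha)).
    by ring.
  by rewrite -[leLHS]real_normK ?num_real // ler_sqr ?nnegrE ?normr_ge0 ?(ltW sa0).
have {}C : cos alpha ^+ 2 = (2 * (cos (p%:~R * alpha) * cos (q%:~R * alpha))) ^+ 2.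
  rewrite -[RHS]sqrrN; congr (_ ^+ 2).
  by rewrite -[RHS]add0r -C; ring.
rewrite !exprMn sin2cos2 sin2cos2 in S2 C.
have cp : cos alpha ^+ 2 <= cos (p%:~R * alpha) ^+ 2.
  have := sqr_ge0 (cos (p%:~R * alpha)); move: C S2.
  have : 0 < cos alpha ^+ 2 by rewrite exprn_gt0.
  set A := cos alpha ^+ 2; set P := cos (p%:~R * _) ^+ 2; set Q := cos (q%:~R * _) ^+ 2.
  move=> A0 C S2 P0.
  suff : (1 - P) * A <= P * (1 - A) by rewrite mulrBl mul1r mulrBr mulr1 lerD2r.
  have -> : (1 - P) * A = P * (2 ^+ 2 * ((1 - P) * Q)) by rewrite C; ring.
  exact: ler_wpM2l.
have [[m Em]|le] := cos_mulstep_le R p l0.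
  have P1 : cos (p%:~R * alpha) ^+ 2 = 1.
    have : cos (p%:~R * (pi / lambda%:R)) = 1 :> R.
      rewrite Em intrM -[(2 * lambda)%N%:Z%:~R]/((2 * lambda)%N%:R : R).
      have -> : m%:~R * (2 * lambda)%N%:R * (pi / lambda%:R) = 0 + m%:~R * (2 * pi) :> R.
        by rewrite natrM; field; rewrite pnatr_eq0; lia.
      by rewrite cosD_int2pi cos0.
    by rewrite cos_dbl; lra.
  have n2 : (2 < 2 * lambda)%N by lia.
  (* [p + q = 2i + 1] is odd and here [p] is even. *)
  have oq : odd `|q| by rewrite /q; move: Em; rewrite /p; lia.
  have /eqP := @twice_odd_cos_neq R (2 * lambda) q n2 oq; apply.
  by rewrite -/alpha C P1; ring.
have : 4 * cos (q%:~R * alpha) ^+ 2 = 1.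
  have : cos (p%:~R * alpha) ^+ 2 = cos alpha ^+ 2.
    apply: le_anti; rewrite cp andbT.
    move: le; rewrite -[X in cos X <= _]/(p%:~R * _) cos_dbl.
    by rewrite -[pi / _]mul1r (cos_dbl 1) mul1r; lra.
  move=> E; rewrite E in C.
  have A0 : cos alpha ^+ 2 != 0 by rewrite expf_neq0 // gt_eqF.
  apply: (mulfI A0); rewrite mulr1 [RHS]C; ring.
move/(cos_half_dvd3 tl0); rewrite Euclid_dvdM // => /orP[//|].
exact/negP.
Qed.

Lemma cos_third_gt : (3 < lambda)%N -> 1 / 2 < cos (pi / lambda%:R) :> R.
Proof.
move=> l3; have pi0 : 0 < pi :> R := pi_gt0 R.
have l3R : 3 < lambda%:R :> R by rewrite ltr_nat.
have c3 := cos_pi3 R.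
have I3 : (pi / 3 : R) \in `[0, pi] by rewrite in_itv /=; apply/andP; split; lra.
have Il : (pi / lambda%:R : R) \in `[0, pi].
  rewrite in_itv /= divr_ge0 ?(ltW pi0) //= ler_pdivrMr ?ler_peMr //; lra.
rewrite -c3 ltr_cos // ltr_pM2l // ltf_pV2 ?posrE //; lra.
Qed.

(** A side normal is orthogonal to a vertex only when [lambda] is odd, while
    [sin alpha >= 1 / 2] forces [lambda <= 3]; this leaves [lambda = 3]. *)
Lemma no_facet_across j : cos (odd_angle j) = 0 -> 1 <= 4 * sin alpha ^+ 2 -> False.
Proof.
move=> c0 s1; have l0 : lambda%:R != 0 :> R by rewrite pnatr_eq0; lia.
have pi0 : pi != 0 :> R by rewrite gt_eqF ?pi_gt0.
have [l3|l3] := ltnP 3 lambda.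
  have := cos_third_gt l3; rewrite -halfstep_double cos_mulr2n.
  by move: s1; rewrite sin2cos2; lra.
have {l3} l2 : lambda = 2%N by move: lambda2 lambda3 l3; case: lambda => [|[|[|[|]]]].
have : cos ((2 * j + 1)%:~R * (pi / lambda%:R) + pi) = 1 :> R.
  by rewrite cosDpi cos_dbl -/(odd_angle j) c0; ring.
case/cos_eq1 => m Em.
have : 2 * j + 1 + 2 = 2 * m * 2 :> int; last by lia.
apply: (@intr_inj R); apply: (mulIf (x := pi / 2)).
  by rewrite mulf_neq0 // invr_eq0.
transitivity ((2 * j + 1)%:~R * (pi / lambda%:R) + pi : R).
  by rewrite l2 !intrD; field.
by rewrite Em !intrM; field.
Qed.
End HalfStep.

(** * A norm with a regular polygon as unit circle *)
Section PolygonalNorm.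
Set Implicit Arguments.
Unset Strict Implicit.
Unset Printing Implicit Defensive.
Variables (R : realType) (lambda : nat).
Hypothesis lambda2 : (2 <= lambda)%N.
Implicit Types (i j k : int) (x y v h : 'rV[R]_2).

Notation alpha := (halfstep R lambda).

(** The coordinates of [x] in the orthonormal frame whose first axis has
    direction [phi]. *)
Definition along (phi : R) x : R := x 0 0 * cos phi + x 0 1 * sin phi.
Definition across (phi : R) x : R := x 0 1 * cos phi - x 0 0 * sin phi.

Lemma alongD phi x y : along phi (x + y) = along phi x + along phi y.
Proof. by rewrite /along !mxE; ring. Qed.

Lemma alongZ phi a x : along phi (a *: x) = a * along phi x.
Proof. by rewrite /along !mxE; ring. Qed.

Lemma along_add phi t x :
  along (phi + t) x = cos t * along phi x + sin t * across phi x.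
Proof. by rewrite /along /across cosD sinD; ring. Qed.

Lemma along_polar phi rho psi : along phi (polar rho psi) = rho * cos (phi - psi).
Proof. by rewrite /along /polar !mxE /= cosB; ring. Qed.

Lemma across_polar phi rho psi : across phi (polar rho psi) = - (rho * sin (phi - psi)).
Proof. by rewrite /across /polar !mxE /= sinB; ring. Qed.

Lemma polar_along phi x : across phi x = 0 -> x = polar (along phi x) phi.
Proof.
move=> h; have cs := cos2Dsin2 phi.
have E0 : x 0 0 = along phi x * cos phi - across phi x * sin phi.
  transitivity (x 0 0 * (cos phi ^+ 2 + sin phi ^+ 2)); first by rewrite cs mulr1.
  by rewrite /along /across; ring.
have E1 : x 0 1 = along phi x * sin phi + across phi x * cos phi.
  transitivity (x 0 1 * (cos phi ^+ 2 + sin phi ^+ 2)); first by rewrite cs mulr1.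
  by rewrite /along /across; ring.
apply/rowP => i; rewrite !mxE.
case: i => [[|[|//]] hi] /=.
  rewrite -[RHS](subr0 _) -[X in _ - X](mul0r (sin phi)) -h -E0.
  by congr (x _ _); apply: val_inj.
rewrite -[RHS](addr0 _) -[X in _ + X](mul0r (cos phi)) -h -E1.
by congr (x _ _); apply: val_inj.
Qed.

Variables (N : 'rV[R]_2 -> R) (r theta : R).
Hypothesis normN : is_norm N.
Hypothesis r0 : 0 < r.
Hypothesis polygonN : [set x | N x = 1] = \bigcup_(k < (2 * lambda)%N)
  segment (regular_vertex (2 * lambda)%N r theta k)
          (regular_vertex (2 * lambda)%N r theta k.+1).

(** Vertices and sides are indexed by integers, so that neighbours and index
    differences need no reduction modulo [2 * lambda]; side [k] joins the
    vertices [k] and [k + 1]. *)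
Definition vertex_angle k : R := theta + (2 * k)%:~R * alpha.
Definition vertex k : 'rV[R]_2 := polar r (vertex_angle k).

(** The linear form equal to 1 on side [j]: the normal of the side has direction
    [vertex_angle j + alpha], and [r * cos alpha] is the apothem. *)
Definition facet j x : R :=
  along (vertex_angle j + alpha) x / (r * cos alpha).

Lemma vertexE (k : nat) :
  regular_vertex (2 * lambda)%N r theta k = vertex k.
Proof.
rewrite /regular_vertex /vertex /vertex_angle; congr (polar _ (_ + _)).
by rewrite /halfstep intrM -[k%:Z%:~R]/(k%:R : R); ring.
Qed.

Let ca0 : 0 < cos alpha := cos_halfstep_gt0 R lambda2.
Let sa0 : 0 < sin alpha := sin_halfstep_gt0 R lambda2.
Let rca0 : 0 < r * cos alpha := mulr_gt0 r0 ca0.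

Lemma facetD j x y : facet j (x + y) = facet j x + facet j y.
Proof. by rewrite /facet alongD mulrDl. Qed.

Lemma facetZ j a x : facet j (a *: x) = a * facet j x.
Proof. by rewrite /facet alongZ mulrA. Qed.

Lemma facet_lin j a b x y : facet j (a *: x + b *: y) = a * facet j x + b * facet j y.
Proof. by rewrite facetD (facetZ j a) (facetZ j b). Qed.

Lemma facetN j x : facet j (- x) = - facet j x.
Proof. by rewrite -scaleN1r facetZ mulN1r. Qed.

Lemma facetB j x y : facet j (x - y) = facet j x - facet j y.
Proof. by rewrite facetD facetN. Qed.

(** Forms are compared in the frame of a vertex [k], where they only depend on
    the difference of the indices. *)
Lemma facet_frame j k x : facet j x =
  (cos (odd_angle R lambda (j - k)) * along (vertex_angle k) x +
   sin (odd_angle R lambda (j - k)) * across (vertex_angle k) x) / (r * cos alpha).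
Proof.
rewrite /facet -along_add; congr (along _ _ / _).
by rewrite /vertex_angle /odd_angle !intrD !intrM intrB; ring.
Qed.

Lemma facet_vertex j k :
  facet j (vertex k) = cos (odd_angle R lambda (j - k)) / cos alpha.
Proof.
rewrite (facet_frame j k) /vertex along_polar across_polar subrr cos0 sin0.
by field; rewrite !gt_eqF.
Qed.

Lemma facet_vertex_le1 j k : facet j (vertex k) <= 1.
Proof. by rewrite facet_vertex ler_pdivrMr // mul1r cos_odd_le. Qed.

Lemma odd_angle0 : odd_angle R lambda 0 = alpha.
Proof. by rewrite /odd_angle mulr0 add0r mul1r. Qed.

Lemma odd_angleN1 : odd_angle R lambda (- 1) = - alpha.
Proof. by rewrite /odd_angle -[2 * -1 + 1]/(- (1 : int)) mulrNz mulN1r. Qed.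

Lemma facet_vertex_self k : facet k (vertex k) = 1.
Proof. by rewrite facet_vertex subrr odd_angle0 divff // gt_eqF. Qed.

Lemma facet_vertex_succ k : facet k (vertex (k + 1)) = 1.
Proof.
by rewrite facet_vertex opprD addNKr odd_angleN1 cosN divff // gt_eqF.
Qed.

Lemma facet_vertex_pred k : facet (k - 1) (vertex k) = 1.
Proof. by rewrite -{2}(subrK 1 k) facet_vertex_succ. Qed.

Lemma vertex_neq0 k : vertex k != 0.
Proof.
apply/eqP => E; have := facet_vertex_self k; rewrite E -(scale0r (0 : 'rV[R]_2)).
by rewrite facetZ mul0r => /eqP; rewrite eq_sym oner_eq0.
Qed.

(** With [d] the angle between the normals of sides [j] and [k], the hypotheses
    read [cos (d + alpha) = cos (d - alpha) = cos alpha]; adding them gives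
    [cos d = 1]. *)
Lemma facet_cone_unique j k : facet j (vertex k) = 1 ->
  facet j (vertex (k + 1)) = 1 -> facet j =1 facet k.
Proof.
have E : odd_angle R lambda (j - k) = (2 * (j - k))%:~R * alpha + alpha.
  by rewrite /odd_angle intrD; ring.
have E1 : odd_angle R lambda (j - (k + 1)) = (2 * (j - k))%:~R * alpha - alpha.
  by rewrite /odd_angle !intrM !intrD !intrM !intrB; ring.
rewrite !facet_vertex E E1 cosB cosD.
set d := _ * alpha => /divr1_eq h1 /divr1_eq h2.
have c1 : cos d = 1.
  apply: (mulIf (x := cos alpha)); first by rewrite gt_eqF.
  by lra.
have s1 : sin d = 0 by apply: cos1sin0; rewrite c1 normr1.
move=> x; rewrite !(facet_frame _ k) subrr E odd_angle0 -/d.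
by rewrite cosD sinD c1 s1 !mul1r !mul0r subr0 add0r.
Qed.

Lemma norm0 : N 0 = 0.
Proof. by rewrite -(scale0r (0 : 'rV[R]_2)) norm_scale // normr0 mul0r. Qed.

Lemma normNN x : N (- x) = N x.
Proof. by rewrite -scaleN1r norm_scale // normrN1 mul1r. Qed.

Lemma norm_ge0 x : 0 <= N x.
Proof.
have := norm_triangle normN x (- x); rewrite subrr norm0 normNN.
lra.
Qed.

Lemma norm_gt0 x : x != 0 -> 0 < N x.
Proof.
move=> x0; rewrite lt_neqAle norm_ge0 andbT eq_sym.
by apply/eqP => /(norm_eq0 normN)/eqP; exact/negP.
Qed.

(** The polygon is the unit circle, so a nonzero vector divided by its norm lies
    on some side; thus the norm is linear on the cone over each side. *)
Lemma norm_cone x : exists (k : nat) (a b : R),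
  [/\ (k < 2 * lambda)%N, 0 <= a, 0 <= b, x = a *: vertex k + b *: vertex (k%:Z + 1)
    & N x = a + b].
Proof.
have [->|x0] := eqVneq x 0.
  exists 0%N, 0, 0; split=> //; first by lia.
    by rewrite !scale0r addr0.
  by rewrite norm0 addr0.
have Nx := norm_gt0 x0.
have : [set x | N x = 1] ((N x)^-1 *: x).
  by rewrite /= norm_scale // ger0_norm ?invr_ge0 ?(ltW Nx) // mulVf // gt_eqF.
rewrite polygonN => -[k /= kl [s /=]]; rewrite in_itv /= => /andP[s0 s1] E.
exists k, (N x * (1 - s)), (N x * s); split=> //.
- by rewrite mulr_ge0 ?subr_ge0 ?(ltW Nx).
- by rewrite mulr_ge0 ?(ltW Nx).
- rewrite -!scalerA -scalerDr.
  have -> : k%:Z + 1 = k.+1%:Z by lia.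
  by rewrite -!vertexE E scalerA mulfV ?scale1r // gt_eqF.
- by ring.
Qed.

(** On each cone the norm is linear and every form is at most 1 at the two
    vertices.  With [facet_attained], the norm is the maximum of the forms. *)
Lemma facet_le_norm j x : facet j x <= N x.
Proof.
have [k [a [b [_ a0 b0 -> ->]]]] := norm_cone x.
rewrite facet_lin; apply: lerD; rewrite ler_piMr //.
  exact: facet_vertex_le1.
exact: facet_vertex_le1.
Qed.

Lemma facet_attained x : exists2 k : nat, (k < 2 * lambda)%N & facet k x = N x.
Proof.
have [k [a [b [kl a0 b0 -> ->]]]] := norm_cone x.
by exists k => //; rewrite facet_lin facet_vertex_self facet_vertex_succ !mulr1.
Qed.

Lemma norm_vertex k : N (vertex k) = 1.
Proof.
apply: le_anti; rewrite -{2}(facet_vertex_self k) facet_le_norm andbT.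
by have [j _ <-] := facet_attained (vertex k); exact: facet_vertex_le1.
Qed.

(** A form strictly below the norm at [v] stays below it near [v]; finitely many
    forms can be treated at once. *)
Lemma inactive_facet_stable v h n : exists2 e0 : R, 0 < e0 &
  forall e, 0 < e <= e0 -> forall k : nat, (k < n)%N -> facet k v != N v ->
  facet k (v + e *: h) < N (v + e *: h).
Proof.
elim: n => [|n [e1 e10 IH]]; first by exists 1.
have [act|inact] := eqVneq (facet n v) (N v).
  exists e1 => // e he k; rewrite ltnS leq_eqVlt => /orP[/eqP ->|]; last exact: IH.
  by rewrite act eqxx.
have g0 : 0 < N v - facet n v by rewrite subr_gt0 lt_neqAle inact facet_le_norm.
(* Moving by [e] closes the gap by at most [e * (facet n h + N h)]. *)
have B0 : 0 < facet n h + N h + 1.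
  by have := facet_le_norm n (- h); rewrite facetN normNN; lra.
exists (Num.min e1 ((N v - facet n v) / (facet n h + N h + 1))).
  by rewrite lt_min e10 divr_gt0.
move=> e /andP[ep]; rewrite le_min => /andP[ee1 eg] k.
rewrite ltnS leq_eqVlt => /orP[/eqP ->|kn nk]; last by apply: IH => //; rewrite ep.
move=> _; rewrite facetD facetZ.
have T : N v <= N (v + e *: h) + e * N h.
  have := norm_triangle normN (v + e *: h) (- (e *: h)).
  by rewrite addrK normNN norm_scale // gtr0_norm.
move: eg; rewrite ler_pdivlMr // => eg.
apply: lt_le_trans (_ : N v - e * N h <= _); last by lra.
nra.
Qed.

(** Near [v] the norm is the maximum of the forms active at [v], hence along any
    ray it grows at the rate of one of them. *)
Lemma norm_ray v h : exists2 e0 : R, 0 < e0 &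
  forall e, 0 < e <= e0 -> exists2 j,
  facet j v = N v & N (v + e *: h) = N v + e * facet j h.
Proof.
have [e0 e00 H] := inactive_facet_stable v h (2 * lambda)%N.
exists e0 => // e /H{}H; have [k kl ak] := facet_attained (v + e *: h).
have actk : facet k v = N v.
  by apply/eqP; apply: contraT => nk; have := H k kl nk; rewrite ak ltxx.
by exists k%:Z => //; rewrite -ak facetD facetZ actk.
Qed.

Lemma cone_interior_facet k a b : 0 < a -> 0 < b ->
  let v := a *: vertex k + b *: vertex (k + 1) in
  facet k v = a + b /\
  (forall j, facet j v = a + b -> facet j =1 facet k).
Proof.
move=> a0 b0 v; rewrite /v; split.
  by rewrite facet_lin facet_vertex_self facet_vertex_succ !mulr1.
move=> j; rewrite facet_lin => E.
have h1 := facet_vertex_le1 j k; have h2 := facet_vertex_le1 j (k + 1).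
apply: facet_cone_unique; nra.
Qed.

(** Inside the cone over a side only the form of this side is active; several
    distinct forms are active only on the ray through a vertex. *)
Lemma active_facets v : v != 0 ->
  (exists k, forall j, facet j v = N v -> facet j =1 facet k) \/
  (exists k c, 0 < c /\ v = c *: vertex k).
Proof.
move=> v0; have [k [a [b [_ a0 b0 Ev EN]]]] := norm_cone v.
move: a0; rewrite le_eqVlt => /orP[/eqP a0|a0].
  right; exists (k%:Z + 1), b; split; last by rewrite Ev -a0 scale0r add0r.
  by have := norm_gt0 v0; rewrite EN -a0 add0r.
move: b0; rewrite le_eqVlt => /orP[/eqP b0|b0].
  by right; exists k%:Z, a; split=> //; rewrite Ev -b0 scale0r addr0.
left; exists k%:Z => j; rewrite EN Ev.
by have [_] := cone_interior_facet k a0 b0; apply.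
Qed.

(** * Uniqueness of the minimiser *)
Definition dist_sum x y z p : R := N (p - x) + N (p - y) + N (p - z).

(** Testing minimality in the direction orthogonal to a vertex isolates the sine
    components of the gradients. *)
Lemma facet_vertex_quarter j k :
  facet j (polar r (vertex_angle k + pi / 2)) =
  sin (odd_angle R lambda (j - k)) / cos alpha.
Proof.
rewrite (facet_frame j k) along_polar across_polar opprD addNKr cosN sinN.
rewrite cos_pihalf sin_pihalf; field; by rewrite !gt_eqF.
Qed.

(** The two ways in which a segment of minimisers of direction [d] can pass, as
    seen from one of the given points, through a point where the active forms
    are those of [act]: either the norm is differentiable there, with a single
    active form, or both the point and [d] lie on the line through a vertex. *)
Definition rigid_or_radial (act : int -> Prop) (d : 'rV[R]_2) : Prop :=
  (exists k, forall j, act j -> facet j =1 facet k) \/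
  (exists k t, [/\ t != 0, d = t *: vertex k &
                   forall j, act j -> facet j (vertex k) = 1]).

(** In this section [act1], [act2] and [act3] are the sets of forms active at
    the differences between a minimiser and the three given points, and [d] is
    the direction of a segment of minimisers. *)
Section Balance.
Hypothesis lambda3 : ~~ (3 %| lambda)%N.
Variables (act1 act2 act3 : int -> Prop) (d : 'rV[R]_2).
Hypothesis descent : forall h, exists j1 j2 j3, [/\ act1 j1, act2 j2, act3 j3 &
  0 <= facet j1 h + facet j2 h + facet j3 h].

(** If all three norms are differentiable at the minimiser, their gradients add
    up to zero: three side normals at 120 degrees. *)
Lemma rigid_unbalanced :
  (exists k, forall j, act1 j -> facet j =1 facet k) ->
  (exists k, forall j, act2 j -> facet j =1 facet k) ->
  (exists k, forall j, act3 j -> facet j =1 facet k) -> False.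
Proof.
move=> [k1 H1] [k2 H2] [k3 H3].
have pos h : 0 <= facet k1 h + facet k2 h + facet k3 h.
  by have [j1 [j2 [j3 [/H1<- /H2<- /H3<-]]]] := descent h.
have bal h : facet k1 h + facet k2 h + facet k3 h = 0.
  by apply: le_anti; rewrite pos andbT; have := pos (- h); rewrite !facetN; lra.
have := bal (vertex 0); have := bal (polar r (vertex_angle 0 + pi / 2)).
rewrite !facet_vertex_quarter !facet_vertex !subr0 -!mulrDl.
have ca : cos alpha != 0 by rewrite gt_eqF.
move=> /eqP; rewrite mulf_eq0 invr_eq0 (negbTE ca) orbF => /eqP S.
move=> /eqP; rewrite mulf_eq0 invr_eq0 (negbTE ca) orbF => /eqP C.
by move: lambda3; rewrite (unit_triple_dvd3 lambda2 C S).
Qed.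

Hypothesis flat : forall j1 j2 j3, act1 j1 -> act2 j2 -> act3 j3 ->
  facet j1 d + facet j2 d + facet j3 d = 0.

(** Take the vertex [k] parallel to [d] as first axis, with [C j] and [S j] the
    components of the normal of side [j].  Constancy along [d] says that the
    three components [C] add up to zero, and minimality in the orthogonal
    directions that the sum of the components [S] can be made nonnegative and
    nonpositive by a choice of active forms.  A form active on the axis has
    [C j = cos alpha] or [- cos alpha], hence [S j] between [- sin alpha] and
    [sin alpha].  With one point on the axis [no_edge_sum] applies.  With two,
    their components [C] must cancel, so the third normal is orthogonal to the
    axis with [S j = 1] or [-1], which [no_facet_across] excludes.  With three,
    the components [C] cannot cancel. *)
Lemma radial_unbalanced k t : t != 0 -> d = t *: vertex k ->
  (forall j, act1 j -> facet j (vertex k) = 1) ->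
  rigid_or_radial act2 d -> rigid_or_radial act3 d -> False.
Proof.
move=> t0 Ed H1 T2 T3.
pose C j := cos (odd_angle R lambda (j - k)).
pose S j := sin (odd_angle R lambda (j - k)).
have ca : cos alpha != 0 by rewrite gt_eqF.
have fd j : facet j d = t * (C j / cos alpha) by rewrite Ed facetZ facet_vertex.
have C1 j : act1 j -> C j = cos alpha.
  by move/H1; rewrite facet_vertex => /divr1_eq.
have CS j : C j ^+ 2 + S j ^+ 2 = 1 by exact: cos2Dsin2.
have cs : cos alpha ^+ 2 + sin alpha ^+ 2 = 1 by exact: cos2Dsin2.
have S_le j : C j ^+ 2 = cos alpha ^+ 2 -> `|S j| <= sin alpha.
  move=> E; have {}E : S j ^+ 2 = sin alpha ^+ 2 by have := CS j; lra.
  by move/eqP: E; rewrite eqf_sqr => /orP[] /eqP ->; rewrite ?normrN gtr0_norm.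
(* [d] is parallel to the axis, so constancy along [d] concerns [C] alone. *)
have flatC j1 j2 j3 : act1 j1 -> act2 j2 -> act3 j3 -> cos alpha + C j2 + C j3 = 0.
  move=> a1 a2 a3; have := flat a1 a2 a3; rewrite !fd -!mulrDr -!mulrDl (C1 _ a1).
  by move/eqP; rewrite !mulf_eq0 invr_eq0 (negbTE t0) (negbTE ca) orbF => /eqP.
have up : exists j1 j2 j3, [/\ act1 j1, act2 j2, act3 j3 & 0 <= S j1 + S j2 + S j3].
  have [j1 [j2 [j3 [a1 a2 a3]]]] := descent (polar r (vertex_angle k + pi / 2)).
  rewrite !facet_vertex_quarter -!mulrDl pmulr_lge0 ?invr_gt0 // => H.
  by exists j1, j2, j3.
have down : exists j1 j2 j3, [/\ act1 j1, act2 j2, act3 j3 & S j1 + S j2 + S j3 <= 0].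
  have [j1 [j2 [j3 [a1 a2 a3]]]] := descent (- polar r (vertex_angle k + pi / 2)).
  rewrite !facetN !facet_vertex_quarter -!opprD oppr_ge0 -!mulrDl.
  rewrite pmulr_lle0 ?invr_gt0 // => H.
  by exists j1, j2, j3.
(* Either [S] takes one value on the active forms, or they are active on the axis. *)
have type act : rigid_or_radial act d -> (exists s, forall j, act j -> S j = s) \/
    (forall j, act j -> C j = cos alpha \/ C j = - cos alpha).
  case=> [[i Hi]|[i [u [u0 Eu Hi]]]].
    left; exists (S i) => j /Hi /(_ (polar r (vertex_angle k + pi / 2))).
    by rewrite !facet_vertex_quarter => /(mulIf _); apply; rewrite invr_eq0.
  right=> j /Hi fj.
  have E : t * (C j / cos alpha) = u by rewrite -fd Eu facetZ fj mulr1.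
  have tu : `|t| = `|u|.
    have := congr1 N Ed; rewrite {1}Eu (norm_scale normN u) (norm_scale normN t).
    by rewrite !norm_vertex !mulr1.
  have : C j ^+ 2 == cos alpha ^+ 2.
    have : t ^+ 2 = u ^+ 2.
      by rewrite -[LHS]real_normK ?num_real // tu real_normK ?num_real.
    rewrite -E exprMn -[LHS]mulr1 => /(mulfI _) H.
    have {}H := H (expf_neq0 2 t0).
    have c2 : cos alpha ^+ 2 != 0 by rewrite expf_neq0.
    by move: H; rewrite exprMn exprVn => /esym/divr1_eq ->.
  by rewrite eqf_sqr => /orP[] /eqP; [left|right].
have [u1 [u2 [u3 [au1 au2 au3 U]]]] := up.
have [v1 [v2 [v3 [av1 av2 av3 V]]]] := down.
have S1 j : act1 j -> - sin alpha <= S j <= sin alpha.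
  by move=> a1; rewrite -ler_norml S_le // C1.
have SB j : C j = cos alpha \/ C j = - cos alpha -> - sin alpha <= S j <= sin alpha.
  by move=> H; rewrite -ler_norml S_le //; case: H => ->; rewrite ?sqrrN.
have /andP[Su1l Su1h] := S1 _ au1; have /andP[Sv1l Sv1h] := S1 _ av1.
case: (type _ T2) (type _ T3) => [[s2 H2]|H2] [[s3 H3]|H3].
- apply: (no_edge_sum lambda2 lambda3 (flatC _ _ _ au1 au2 au3)).
  rewrite -/(S u2) -/(S u3) ler_norml; move: U V.
  rewrite (H2 _ au2) (H2 _ av2) (H3 _ au3) (H3 _ av3) => U V.
  by apply/andP; split; lra.
- have E := flatC _ _ _ au1 au2 au3.
  have /andP[? ?] := SB _ (H3 _ au3); have /andP[? ?] := SB _ (H3 _ av3).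
  rewrite (H2 _ au2) in U; rewrite (H2 _ av2) in V.
  have c0 : C u2 = 0.
    case: (H3 _ au3) => E3; last by lra.
    by have := cos_odd_ge R lambda2 (u2 - k); rewrite -/(C u2); move: ca0; lra.
  apply: (no_facet_across lambda2 lambda3 c0).
  by have := CS u2; rewrite c0 (H2 _ au2); nra.
- have E := flatC _ _ _ au1 au2 au3.
  have /andP[? ?] := SB _ (H2 _ au2); have /andP[? ?] := SB _ (H2 _ av2).
  rewrite (H3 _ au3) in U; rewrite (H3 _ av3) in V.
  have c0 : C u3 = 0.
    case: (H2 _ au2) => E3; last by lra.
    by have := cos_odd_ge R lambda2 (u3 - k); rewrite -/(C u3); move: ca0; lra.
  apply: (no_facet_across lambda2 lambda3 c0).
  by have := CS u3; rewrite c0 (H3 _ au3); nra.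
- have := flatC _ _ _ au1 au2 au3.
  by case: (H2 _ au2) => ->; case: (H3 _ au3) => ->; move: ca0; lra.
Qed.
End Balance.

Definition midpoint (p q : 'rV[R]_2) : 'rV[R]_2 := 2^-1 *: p + 2^-1 *: q.

Lemma midpointB p q x : midpoint p q - x = 2^-1 *: (p - x) + 2^-1 *: (q - x).
Proof.
have half : 2^-1 + 2^-1 = 1 :> R by field.
by rewrite /midpoint !scalerBr addrACA -opprD -scalerDl half scale1r.
Qed.

Lemma norm_midpoint_le p q x :
  N (midpoint p q - x) <= (N (p - x) + N (q - x)) / 2.
Proof.
have := norm_triangle normN (2^-1 *: (p - x)) (2^-1 *: (q - x)).
rewrite midpointB (norm_scale normN 2^-1 (p - x)) (norm_scale normN 2^-1 (q - x)).
by rewrite gtr0_norm ?invr_gt0 //; lra.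
Qed.

(** If the norm is affine between two points, a form active at the midpoint,
    being below the norm at both ends, is active at both ends. *)
Lemma midpoint_active p q x j :
  N (midpoint p q - x) = (N (p - x) + N (q - x)) / 2 ->
  facet j (midpoint p q - x) = N (midpoint p q - x) ->
  facet j (p - x) = N (p - x) /\ facet j (q - x) = N (q - x).
Proof.
move=> ->; rewrite midpointB facet_lin => E.
have := facet_le_norm j (p - x); have := facet_le_norm j (q - x).
by move=> *; split; lra.
Qed.

(** When the midpoint lies on the ray through vertex [k], the forms of the two
    sides meeting there are active at both ends of the segment, so they agree on
    its direction; they agree exactly on the line through the vertex. *)
Lemma midpoint_rigid_or_radial p q x : p != q ->
  N (midpoint p q - x) = (N (p - x) + N (q - x)) / 2 ->
  rigid_or_radial (fun j => facet j (midpoint p q - x) = N (midpoint p q - x)) (q - p).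
Proof.
move=> pq E; set m := midpoint p q - x.
(* At the midpoint, norm zero would force norm zero at both ends. *)
have m0 : m != 0.
  apply/eqP => m0; move: E; rewrite -/m m0 norm0 => E.
  have := norm_ge0 (p - x); have := norm_ge0 (q - x) => q0 p0.
  have /(norm_eq0 normN)/subr0_eq px : N (p - x) = 0 by lra.
  have /(norm_eq0 normN)/subr0_eq qx : N (q - x) = 0 by lra.
  by move: pq; rewrite px qx eqxx.
case: (active_facets m0) => [|[k [c [c0 Em]]]]; first by left.
right; exists k.
have act_vertex j : facet j m = N m <-> facet j (vertex k) = 1.
  rewrite Em facetZ (norm_scale normN) norm_vertex gtr0_norm // mulr1.
  split=> [H|->]; last by rewrite mulr1.
  by apply: (mulfI (x := c)); rewrite ?mulr1 // gt_eqF.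
have qpE : q - p = (q - x) - (p - x) by rewrite opprB addrA subrK.
have f1 : facet k (q - p) = facet (k - 1) (q - p).
  have /(midpoint_active E)[p1 q1] : facet k m = N m.
    by apply/act_vertex; exact: facet_vertex_self.
  have /(midpoint_active E)[p2 q2] : facet (k - 1) m = N m.
    by apply/act_vertex; exact: facet_vertex_pred.
  by rewrite qpE (facetB k (q - x)) (facetB (k - 1) (q - x)) p1 q1 p2 q2.
have f2 : across (vertex_angle k) (q - p) = 0.
  move: f1; rewrite !(facet_frame _ k) subrr odd_angle0 addrAC subrr add0r.
  rewrite odd_angleN1 cosN sinN => /divIf; rewrite gt_eqF // => /(_ isT) H.
  have /eqP : 2 * (sin alpha * across (vertex_angle k) (q - p)) = 0 by lra.
  by rewrite !mulf_eq0 pnatr_eq0 /= (gt_eqF sa0) /= => /eqP.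
have qp0 : q - p != 0 by rewrite subr_eq0 eq_sym.
have Eqp : q - p = (along (vertex_angle k) (q - p) / r) *: vertex k.
  rewrite [LHS](polar_along f2) /vertex /polar scalerA; congr (_ *: _).
  by rewrite divfK // gt_eqF.
exists (along (vertex_angle k) (q - p) / r); split=> //; last by move=> j /act_vertex.
by apply: contra_neq qp0 => H; rewrite Eqp H scale0r.
Qed.

Lemma minimizer_descent x y z m : (forall w, dist_sum x y z m <= dist_sum x y z w) ->
  forall h, exists j1 j2 j3,
  [/\ facet j1 (m - x) = N (m - x), facet j2 (m - y) = N (m - y),
      facet j3 (m - z) = N (m - z) & 0 <= facet j1 h + facet j2 h + facet j3 h].
Proof.
move=> min h.
have [e1 e10 H1] := norm_ray (m - x) h.
have [e2 e20 H2] := norm_ray (m - y) h.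
have [e3 e30 H3] := norm_ray (m - z) h.
pose e := Num.min e1 (Num.min e2 e3).
have e0 : 0 < e by rewrite !lt_min e10 e20.
have [j1 a1 E1] : exists2 j, facet j (m - x) = N (m - x) &
    N (m - x + e *: h) = N (m - x) + e * facet j h.
  by apply: H1; rewrite e0 ge_min lexx.
have [j2 a2 E2] : exists2 j, facet j (m - y) = N (m - y) &
    N (m - y + e *: h) = N (m - y) + e * facet j h.
  by apply: H2; rewrite e0 !ge_min lexx orbT.
have [j3 a3 E3] : exists2 j, facet j (m - z) = N (m - z) &
    N (m - z + e *: h) = N (m - z) + e * facet j h.
  by apply: H3; rewrite e0 !ge_min lexx !orbT.
exists j1, j2, j3; split=> //.
rewrite -(pmulr_rge0 _ e0).
have := min (m + e *: h); rewrite /dist_sum ![m + e *: h - _]addrAC E1 E2 E3.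
by lra.
Qed.

(** A convex sum that is constant on a segment has affine terms on it, so the
    midpoint of two minimisers is a minimiser to which the balance analysis
    applies, for whichever of the three points sees the segment along a
    vertex. *)
Lemma minimizer_unique x y z p q : ~~ (3 %| lambda)%N ->
  (forall w, dist_sum x y z p <= dist_sum x y z w) ->
  (forall w, dist_sum x y z q <= dist_sum x y z w) -> p = q.
Proof.
move=> lambda3 minp minq; apply/eqP; apply: contraT => pq; exfalso.
have Epq : dist_sum x y z p = dist_sum x y z q by apply: le_anti; rewrite minp minq.
have lx := norm_midpoint_le p q x; have ly := norm_midpoint_le p q y.
have lz := norm_midpoint_le p q z.
have lm := minp (midpoint p q).
rewrite /dist_sum in Epq lm.
have Ex : N (midpoint p q - x) = (N (p - x) + N (q - x)) / 2 by lra.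
have Ey : N (midpoint p q - y) = (N (p - y) + N (q - y)) / 2 by lra.
have Ez : N (midpoint p q - z) = (N (p - z) + N (q - z)) / 2 by lra.
have minm w : dist_sum x y z (midpoint p q) <= dist_sum x y z w.
  by apply: le_trans (minp w); rewrite /dist_sum; lra.
have descent := minimizer_descent minm.
have flat j1 j2 j3 : facet j1 (midpoint p q - x) = N (midpoint p q - x) ->
    facet j2 (midpoint p q - y) = N (midpoint p q - y) ->
    facet j3 (midpoint p q - z) = N (midpoint p q - z) ->
    facet j1 (q - p) + facet j2 (q - p) + facet j3 (q - p) = 0.
  have facet_diff j w : facet j (q - p) = facet j (q - w) - facet j (p - w).
    by rewrite -facetB; congr (facet _ _); rewrite opprB addrA subrK.
  move=> /(midpoint_active Ex)[p1 q1] /(midpoint_active Ey)[p2 q2].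
  move=> /(midpoint_active Ez)[p3 q3].
  rewrite (facet_diff j1 x) (facet_diff j2 y) (facet_diff j3 z).
  rewrite p1 q1 p2 q2 p3 q3.
  by lra.
have Tx := midpoint_rigid_or_radial pq Ex.
have Ty := midpoint_rigid_or_radial pq Ey.
have Tz := midpoint_rigid_or_radial pq Ez.
case: (Tx) => [Rx|[k [t [t0 Et Hk]]]]; last first.
  exact: (radial_unbalanced lambda3 descent flat t0 Et Hk Ty Tz).
case: (Ty) => [Ry|[k [t [t0 Et Hk]]]]; last first.
  apply: (radial_unbalanced lambda3 _ _ t0 Et Hk Tx Tz).
    move=> h; have [j1 [j2 [j3 [a1 a2 a3 H]]]] := descent h.
    by exists j2, j1, j3; split=> //; rewrite (addrC (facet j2 h)).
  by move=> j1 j2 j3 a1 a2 a3; rewrite (addrC (facet j1 _)); exact: flat.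
case: (Tz) => [Rz|[k [t [t0 Et Hk]]]]; last first.
  apply: (radial_unbalanced lambda3 _ _ t0 Et Hk Tx Ty).
    move=> h; have [j1 [j2 [j3 [a1 a2 a3 H]]]] := descent h.
    by exists j3, j1, j2; split=> //; rewrite -addrA addrC.
  by move=> j1 j2 j3 a1 a2 a3; rewrite -addrA addrC; exact: flat.
exact: (rigid_unbalanced lambda3 descent Rx Ry Rz).
Qed.

(** * Existence of a minimiser *)
Lemma norm_sub_le x y : `|N x - N y| <= N (x - y).
Proof.
have := norm_triangle normN (x - y) y; have := norm_triangle normN (y - x) x.
rewrite !subrK -[y - x]opprB normNN => h1 h2.
by rewrite ler_norml; apply/andP; split; lra.
Qed.

Lemma norm_le_coord x : N x <= (`|x 0 0| + `|x 0 1|) / (r * cos alpha).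
Proof.
have [k _ <-] := facet_attained x; rewrite /facet ler_pM2r ?invr_gt0 //.
by apply: lerD; rewrite (le_trans (ler_norm _)) // normrM ler_piMr // ?cos_max ?sin_max.
Qed.

(** Makes the sum of distances coercive: it is large outside a box. *)
Lemma coord_le_norm x (i : 'I_2) : `|x 0 i| <= r * N x.
Proof.
have V k : `|vertex k 0 i| <= r.
  rewrite !mxE normrM gtr0_norm // ler_piMr ?(ltW r0) //.
  by case: i => [[|[|//]] ?] /=; rewrite ?cos_max ?sin_max.
have [k [a [b [_ a0 b0 Ex ->]]]] := norm_cone x.
have -> : x 0 i = a * vertex k 0 i + b * vertex (k%:Z + 1) 0 i.
  by rewrite [in LHS]Ex mxE [X in X + _]mxE [X in _ + X]mxE.
apply: le_trans (ler_normD _ _) _; rewrite !normrM (ger0_norm a0) (ger0_norm b0).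
by rewrite mulrC [r * _]mulrDr mulrC ![r * _]mulrC lerD // ler_wpM2l.
Qed.

Lemma dist_continuous a : continuous (fun v : 'rV[R]_2 => N (v - a)).
Proof.
move=> v; apply/(@cvgrPdist_le _ _ _ _ (nbhs_filter v)) => e e0.
have d0 : 0 < e * (r * cos alpha) / 2 by rewrite divr_gt0 // mulr_gt0.
have near_coord (i : 'I_2) :
    \forall w \near v, `|v 0 i - (w : 'rV[R]_2) 0 i| <= e * (r * cos alpha) / 2.
  have C : (w : 'rV[R]_2) 0 i @[w --> v] --> v 0 i by exact: coord_continuous.
  by move/(@cvgrPdist_le _ _ _ _ (nbhs_filter v)): C; apply.
near=> w.
apply: le_trans (norm_sub_le _ _) _; rewrite opprB addrA subrK.
apply: le_trans (norm_le_coord _) _.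
rewrite ler_pdivrMr // !mxE.
have : `|v 0 0 - w 0 0| <= e * (r * cos alpha) / 2 by near: w; exact: near_coord.
have : `|v 0 1 - w 0 1| <= e * (r * cos alpha) / 2 by near: w; exact: near_coord.
lra.
Unshelve. all: by end_near.
Qed.

Lemma dist_sum_continuous x y z : continuous (dist_sum x y z).
Proof.
move=> p.
have C a : N (w - a) @[w --> p] --> N (p - a) by exact: dist_continuous.
exact: (cvgD (cvgD (C x) (C y)) (C z)).
Qed.

Lemma minimizer_exists x y z :
  exists p, forall w, dist_sum x y z p <= dist_sum x y z w.
Proof.
(* Outside the box of half-side [M] the sum exceeds its value at 0. *)
pose M := r * (N x + dist_sum x y z 0).
have f_ge w : N w - N x <= dist_sum x y z w.
  rewrite /dist_sum -2![leLHS]addr0; apply: lerD; last exact: norm_ge0.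
  apply: lerD; last exact: norm_ge0.
  exact: le_trans (ler_norm _) (norm_sub_le _ _).
have M0 : 0 <= M.
  apply: mulr_ge0; first exact: ltW.
  by apply: addr_ge0; rewrite ?norm_ge0 // /dist_sum !addr_ge0 // norm_ge0.
pose A := [set v : 'rV[R]_2 | forall i : 'I_2, v ord0 i \in `[- M, M]].
have A0 : A 0 by move=> i; rewrite mxE in_itv /= oppr_le0 M0.
have cA : compact A.
  by apply: (@rV_compact _ _ (fun=> `[- M, M]%classic)) => _; exact: segment_compact.
have [|c _ cmin] := EVT_min_rV (f := dist_sum x y z) (ex_intro _ _ A0) cA.
  by apply: continuous_subspaceT; exact: dist_sum_continuous.
exists c => w; have [Aw|nAw] := pselect (A w); first by apply: cmin; rewrite inE.
apply: le_trans (cmin 0 _) _; first by rewrite inE.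
apply: le_trans (f_ge w).
have [i Hi] : exists i : 'I_2, ~ (w ord0 i \in `[- M, M]) by apply/existsNP.
have : M < `|w ord0 i|.
  by rewrite ltNge; apply/negP; rewrite ler_norml; move: Hi; rewrite in_itv.
move/lt_le_trans/(_ (coord_le_norm w i)); rewrite /M ltr_pM2l //; lra.
Qed.

(** * Several minimisers when 3 divides lambda *)
Lemma facet_thirds k mu x : (lambda = 3 * mu)%N ->
  facet k x + facet (k + (2 * mu)%N%:Z) x + facet (k + (4 * mu)%N%:Z) x = 0.
Proof.
move=> E; have mu0 : mu%:R != 0 :> R by rewrite pnatr_eq0; lia.
have E1 : vertex_angle (k + (2 * mu)%N%:Z) + alpha = vertex_angle k + alpha + pi / 3 *+ 2.
  rewrite /vertex_angle /halfstep E mulrDr !intrD !intrM.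
  by rewrite -[(2 * mu)%N%:Z%:~R]/((2 * mu)%N%:R : R) !natrM; field.
have E2 : vertex_angle (k + (4 * mu)%N%:Z) + alpha =
    vertex_angle k + alpha + pi / 3 *+ 2 *+ 2.
  rewrite /vertex_angle /halfstep E mulrDr !intrD !intrM.
  by rewrite -[(4 * mu)%N%:Z%:~R]/((4 * mu)%N%:R : R) !natrM; field.
rewrite /facet E1 E2 !(along_add (vertex_angle k + alpha)).
rewrite !cos_mulr2n !sin_mulr2n cos_mulr2n cos_pi3 -!mulrDl.
by apply/eqP; rewrite mulf_eq0; apply/orP; left; apply/eqP; field.
Qed.

(** Take the points opposite to the sums of the end vertices of three sides
    spaced by a third of the polygon.  The three forms of these sides cancel and
    are below the norm, so the sum of distances is at least [2 + 2 + 2].  This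
    value is reached at the origin, and also at every nearby point: each sum of
    end vertices is interior to the cone over its side, so the norm stays equal
    to the form of the side around it. *)
Lemma minimizer_not_unique : (3 %| lambda)%N -> exists x y z p q,
  [/\ [/\ x != y, x != z & y != z], p != q,
   forall w, dist_sum x y z p <= dist_sum x y z w &
   forall w, dist_sum x y z q <= dist_sum x y z w].
Proof.
case/dvdnP => mu; rewrite mulnC => Emu.
pose side k := vertex k + vertex (k + 1).
have sideE k : side k = 1 *: vertex k + 1 *: vertex (k + 1) by rewrite !scale1r.
have facet_side k : facet k (side k) = 2.
  by rewrite sideE; have [-> _] := cone_interior_facet k (@ltr01 R) (@ltr01 R); ring.
have N_side k : N (side k) = 2.
  apply: le_anti; rewrite -{2}(facet_side k) facet_le_norm andbT.
  by apply: le_trans (norm_triangle normN _ _) _; rewrite !norm_vertex.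
have side_active j k : facet j (side k) = 2 -> facet j =1 facet k.
  move=> H; have [_] := cone_interior_facet k (@ltr01 R) (@ltr01 R).
  by apply; rewrite -sideE H.
pose k1 : int := 0 + (2 * mu)%N%:Z; pose k2 : int := 0 + (4 * mu)%N%:Z.
have bal x : facet 0 x + facet k1 x + facet k2 x = 0 by exact: facet_thirds.
have facet_geN1 j k : -1 <= facet j (vertex k).
  have := facet_le_norm j (- vertex k).
  by rewrite facetN normNN norm_vertex; lra.
have side_neq a b c : (forall x, facet a x + facet b x + facet c x = 0) ->
    - side a != - side b.
  move=> H; apply/eqP => /oppr_inj E.
  have ab : facet a =1 facet b by apply: side_active; rewrite -E facet_side.
  have := H (vertex a); rewrite -ab facet_vertex_self; have := facet_geN1 c a.
  lra.
have atmost w : 6 <= dist_sum (- side 0) (- side k1) (- side k2) w.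
  rewrite /dist_sum !opprK.
  have := facet_le_norm 0 (w + side 0); have := facet_le_norm k1 (w + side k1).
  have := facet_le_norm k2 (w + side k2); have := bal w.
  by rewrite !(facetD _ w) !facet_side; lra.
have ray k : exists2 e0 : R, 0 < e0 & forall e, 0 < e <= e0 ->
    N (e *: vertex 0 + side k) = 2 + e * facet k (vertex 0).
  have [e0 e00 H] := norm_ray (side k) (vertex 0).
  exists e0 => // e /H[j]; rewrite N_side => /side_active E.
  by rewrite addrC E.
have [e0 e00 H0] := ray 0; have [e1 e10 H1] := ray k1; have [e2 e20 H2] := ray k2.
pose e := Num.min e0 (Num.min e1 e2).
have ep : 0 < e by rewrite !lt_min e00 e10.
exists (- side 0), (- side k1), (- side k2), 0, (e *: vertex 0); split.
- split; [exact: (side_neq _ _ k2)| |].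
    by apply: (side_neq _ _ k1) => x; rewrite addrAC.
  by apply: (side_neq _ _ 0) => x; rewrite -[RHS](bal x); ring.
- by rewrite eq_sym scaler_eq0 (gt_eqF ep) (negbTE (vertex_neq0 0)).
- move=> w; apply: le_trans (atmost w).
  by rewrite /dist_sum !sub0r !opprK !N_side; lra.
- move=> w; apply: le_trans (atmost w).
  rewrite /dist_sum !opprK H0 ?H1 ?H2 ?ep ?ge_min ?lexx ?orbT //.
  by have := congr1 ( *%R e) (bal (vertex 0)); rewrite mulr0 !mulrDr; lra.
Qed.
End PolygonalNorm.

(** * The characterisation *)
Lemma ft_three (R : realType) (N : 'rV[R]_2 -> R) (A : {fset 'rV[R]_2}) :
  #|` A| = 3%N -> exists x y z,
  ft N A = [set p | forall w, dist_sum N x y z p <= dist_sum N x y z w].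
Proof.
case E : (enum_fset A) => [|x [|y [|z [|]]]] // _; exists x, y, z.
have sumE w : \sum_(a <- A) N (w - a) = dist_sum N x y z w.
  by rewrite E !big_cons big_nil addr0 addrA.
by apply/seteqP; split=> p /= H w; have := H w; rewrite !sumE.
Qed.

Lemma ft_fset3 (R : realType) (N : 'rV[R]_2 -> R) (x y z : 'rV[R]_2) :
  x != y -> x != z -> y != z ->
  #|` [fset x; y; z]| = 3%N /\ forall p,
  ft N [fset x; y; z] p <-> forall w, dist_sum N x y z p <= dist_sum N x y z w.
Proof.
move=> xy xz yz.
have zxy : z \notin [fset x; y] by rewrite !inE negb_or ![z == _]eq_sym xz.
have sumE w : \sum_(a <- [fset x; y; z]) N (w - a) = dist_sum N x y z w.
  rewrite fsetUC big_fsetU1 //= fsetUC big_fsetU1 ?inE 1?eq_sym //= big_seq_fset1.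
  by rewrite /dist_sum; ring.
split; first by rewrite fsetUC cardfsU1 zxy cardfs2 xy.
by move=> p; split=> H w; have := H w; rewrite !sumE.
Qed.

Theorem theorem4p9 (R : realType) (lambda : nat) (hlambda : (2 <= lambda)%N)
  (N : 'rV[R]_2 -> R) (hN : is_lambda_norm lambda N) :
  (forall A : {fset 'rV[R]_2}, #|` A| = 3%N ->
     exists x0 : 'rV[R]_2, ft N A = [set x0]) <->
  (lambda <> 0 %[mod 3])%N.
Proof.
have [normN [r [theta [r0 polygonN]]]] := hN.
split.
  move=> uniq mod0; have l3 : (3 %| lambda)%N by rewrite /dvdn mod0.
  have [x [y [z [p [q [[xy xz yz] pq minp minq]]]]]] :=
    minimizer_not_unique hlambda normN r0 polygonN l3.
  have [card3 ftE] := ft_fset3 N xy xz yz.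
  have [x0 ftA] := uniq _ card3.
  have /ftE := minp; rewrite ftA /= => Ep; have /ftE := minq; rewrite ftA /= => Eq.
  by move: pq; rewrite Ep Eq eqxx.
move=> mod0 A card3.
have l3 : ~~ (3 %| lambda)%N by apply/negP => /eqP.
have [x [y [z ->]]] := ft_three N card3.
have [p minp] := minimizer_exists hlambda normN r0 polygonN x y z.
exists p; apply/seteqP; split=> [q minq|_ -> //] /=.
exact: (minimizer_unique hlambda normN r0 polygonN l3 minq minp).
Qed.
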